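(* Let $G$ be an abelian group, $\mathbb{F}$ a field, and $\mathcal{R}=\bigoplus_{g\in G}\mathcal{R}_g$ a $G$-graded unital associative $\mathbb{F}$-algebra. Assume that $\mathcal{R}$ is graded-simple. Let $X\in\mathcal{R}$ be an invertible element such that the inner automorphism $\operatorname{Int}X : Y\mapsto XYX^{-1}$ belongs to the stabilizer of the grading, that is, if $Y$ is a homogeneous element of $\mathcal{R}$, then $(\operatorname{Int}X)(Y)=XYX^{-1}$ is also homogeneous of the same degree. Write $X=\sum_{g\in G}X_g$ with $X_g\in\mathcal{R}_g$. Then any nonzero homogeneous component $X_g$ of $X$ is invertible and determines the same inner automorphism as $X$, that is, $\operatorname{Int}X_g=\operatorname{Int}X$.
   Context: A $G$-grading on an algebra $\mathcal{R}$ is a vector space decomposition $\mathcal{R}=\bigoplus_{g\in G}\mathcal{R}_g$ with $\mathcal{R}_g\mathcal{R}_h\subseteq\mathcal{R}_{gh}$ for all $g,h\in G$; elements of $\mathcal{R}_g$ are called homogeneous (of degree $g$). A subspace $S$ is graded if $S=\bigoplus_{g}(S\cap\mathcal{R}_g)$. The graded algebra $\mathcal{R}$ is graded-simple if $\mathcal{R}\mathcal{R}\neq 0$ and the only graded two-sided ideals of $\mathcal{R}$ are $0$ and $\mathcal{R}$. *)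

(* Defs.v *)
From HB Require Import structures.
From mathcomp Require Import all_boot all_algebra finmap.
From mathcomp Require Import classical_sets.

Set Implicit Arguments.
Unset Strict Implicit.
Unset Printing Implicit Defensive.

Import GRing.Theory.
Local Open Scope ring_scope.
Local Open Scope classical_set_scope.

(* Grading groups are zmodTypes, so the degree of a product is written g + h.
   The carriers are unitAlgTypes only to have x^-1 and GRing.unit: classically
   every nonzero algebra carries such a structure. *)

(* [fsfun] are the finitely supported families, possibly over an infinite G. *)
Definition decomposes (G : zmodType) (F : fieldType) (V : lmodType F)
    (W : G -> set V) (x : V) (f : {fsfun G -> V with 0}) : Prop :=
  (forall g, W g (f g)) /\ x = \sum_(g <- finsupp f) f g.

Definition direct_sum (G : zmodType) (F : fieldType) (V : lmodType F)
    (S : set V) (W : G -> set V) : Prop :=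
  [/\ forall g, GRing.submod_closed (mem (W g)),
      forall g, W g `<=` S
    & forall x, S x -> exists! f : {fsfun G -> V with 0}, decomposes W x f].

Definition grading (G : zmodType) (F : fieldType) (R : unitAlgType F)
    (gr : G -> set R) : Prop :=
  direct_sum [set: R] gr /\
  forall g h x y, gr g x -> gr h y -> gr (g + h) (x * y).

Definition graded_subspace (G : zmodType) (F : fieldType) (R : unitAlgType F)
    (gr : G -> set R) (S : set R) : Prop :=
  GRing.submod_closed (mem S) /\ direct_sum S (fun g => S `&` gr g).

Definition two_sided_ideal (F : fieldType) (R : unitAlgType F)
    (I : set R) : Prop :=
  GRing.submod_closed (mem I) /\
  forall r x, I x -> I (r * x) /\ I (x * r).

Definition graded_simple (G : zmodType) (F : fieldType) (R : unitAlgType F)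
    (gr : G -> set R) : Prop :=
  (exists x y : R, x * y != 0) /\
  forall I : set R, two_sided_ideal I -> graded_subspace gr I ->
    I = [set 0] \/ I = [set: R].

(* Meaningful for invertible X only, since x^-1 = x when x is not a unit. *)
Definition Int (F : fieldType) (R : unitAlgType F) (X Y : R) : R :=
  X * Y * X^-1.

Definition stabilizes (G : zmodType) (F : fieldType) (R : unitAlgType F)
    (gr : G -> set R) (phi : R -> R) : Prop :=
  forall g Y, gr g Y -> gr g (phi Y).

(* Main.v *)
(** For homogeneous Y of degree h one has X Y = (Int X)(Y) X, and both sides
    decompose termwise. As G is abelian, comparing the components of degree
    g + h gives X_g Y = (Int X)(Y) X_g, first for homogeneous Y and then for
    every Y. Hence X_g R = R X_g is a nonzero graded two-sided ideal; it equals R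
    by graded simplicity, so X_g is invertible. *)

Require Import Defs.
From HB Require Import structures.
From mathcomp Require Import all_boot all_algebra finmap.
From mathcomp Require Import classical_sets.

Local Open Scope ring_scope.

Import GRing.Theory.

Section Grading.

Variables (G : zmodType) (F : fieldType) (R : unitAlgType F) (gr : G -> set R).
Hypothesis gr_grading : grading gr.

Lemma decomposes_exists (x : R) : exists f, decomposes gr x f.
Proof.
by case: gr_grading => -[_ _ /(_ x Logic.I)[f [fP _]]] _; exists f.
Qed.

Lemma decomposes_unique (x : R) f1 f2 :
  decomposes gr x f1 -> decomposes gr x f2 -> f1 = f2.
Proof.
case: gr_grading => -[_ _ /(_ x Logic.I)[f [_ fU]]] _ d1 d2.
by rewrite -(fU _ d1) -(fU _ d2).
Qed.

(** Translation by [d] is injective on degrees, so no two components merge under [T]. Applied to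
    multiplication by a homogeneous element, on either side. *)
Lemma decomposes_shift (T : R -> R) (d : G) (x : R)
    (f : {fsfun G -> R with 0}) :
  T 0 = 0 -> {morph T : u v / u + v} ->
  (forall h y, gr h y -> gr (h + d) (T y)) ->
  decomposes gr x f ->
  exists2 f', decomposes gr (T x) f' & forall h, f' (h + d) = T (f h).
Proof.
move=> T0 TD Tgr [fgr ->].
pose S := [fset (h + d)%R | h in finsupp f]%fset.
pose f' : {fsfun G -> R with 0} := [fsfun k in S => T (f (k - d))].
(* For [k] outside [S], [f] vanishes at [k - d], and the default value 0 is [T 0]. *)
have f'E k : f' k = T (f (k - d)).
  rewrite fsfunE; case: ifPn => // kS.
  rewrite [f _]fsfun_dflt ?T0 //; apply: contra kS => kf.
  by apply/imfsetP; exists (k - d) => //=; rewrite subrK.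
have f'S : (finsupp f' `<=` S)%fset by exact: finsupp_sub.
exists f'; last by move=> h; rewrite f'E addrK.
split=> [k|]; first by rewrite f'E -[in gr k](subrK d k); apply: Tgr.
(* [T] may kill components, so [finsupp f'] can be smaller than [S]; the sum is extended to [S] by
   zero terms. *)
rewrite (big_morph T TD T0) (big_fset_incl _ f'S) /=; last first.
  by move=> k _ /fsfun_dflt.
rewrite big_imfset /=; last by move=> h k _ _ /addIr.
by apply: eq_bigr => h _; rewrite f'E addrK.
Qed.

Lemma component_intertwines (X : R) (Xc : {fsfun G -> R with 0}) (g : G) :
  X \is a GRing.unit -> stabilizes gr (Int X) -> decomposes gr X Xc ->
  forall Y, Xc g * Y = Int X Y * Xc g.
Proof.
move=> X_unit X_stab X_dec.
have hom h y : gr h y -> Xc g * y = Int X y * Xc g.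
  move=> hy; have [_ grM] := gr_grading.
  have [f1 d1 e1] : exists2 f1, decomposes gr (X * y) f1 &
      forall k, f1 (k + h) = Xc k * y.
    apply: (decomposes_shift (fun u => u * y)) X_dec => [|u v|k u ku].
    - by rewrite mul0r.
    - by rewrite mulrDl.
    - exact: grM.
  have [f2 d2 e2] : exists2 f2, decomposes gr (Int X y * X) f2 &
      forall k, f2 (k + h) = Int X y * Xc k.
    apply: (decomposes_shift (fun u => Int X y * u)) X_dec => [|u v|k u ku].
    - by rewrite mulr0.
    - by rewrite mulrDr.
    (* Commutativity of [G] turns the degree [h + k] into [k + h], so both products are indexed
       alike. *)
    - by rewrite addrC; apply: grM => //; apply: X_stab.
  have IntX : Int X y * X = X * y by rewrite /Int divrK.
  rewrite IntX in d2.
  by rewrite -e1 -e2 (decomposes_unique _ _ _ d1 d2).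
move=> Y; have [f [fgr ->]] := decomposes_exists Y.
rewrite /Int !(mulr_sumr, mulr_suml); apply: eq_bigr => h _.
exact: hom (fgr h).
Qed.

(** The components of [a * y] are [a] times those of [y], hence again right multiples of [a]. *)
Lemma principal_graded (a : R) (d : G) : gr d a ->
  graded_subspace gr [set x | exists y, x = a * y]%classic.
Proof.
move=> ad; set I := [set x | _]%classic.
have [[gr_sub _ _] grM] := gr_grading.
have Isub : GRing.submod_closed (mem I).
  split=> [|c u v]; rewrite ?inE; first by exists 0; rewrite mulr0.
  by move=> [y ->] [z ->]; exists (c *: y + z); rewrite mulrDr scalerAr.
split=> //; split=> [k|k x []//|x [y ->]].
  have [I0 IL] := Isub; have [k0 kL] := gr_sub k.
  split=> [|c u v]; first by move: I0 k0; rewrite !inE.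
  have := IL c u v; have := kL c u v; rewrite !inE => kuv Iuv [Iu ku] [Iv kv].
  by split; [apply: Iuv | apply: kuv].
have [f fd] := decomposes_exists y.
have [f' f'd f'E] : exists2 f', decomposes gr (a * y) f' &
    forall k, f' (k + d) = a * f k.
  apply: (decomposes_shift (fun u => a * u)) fd => [|u v|k u ku].
  - by rewrite mulr0.
  - by rewrite mulrDr.
  - by rewrite addrC; apply: grM.
exists f'; split.
  case: (f'd) => f'gr f's; split=> // k; split=> //.
  by exists (f (k - d)); rewrite -f'E subrK.
(* A decomposition inside the ideal is also one in [R], where it is unique. *)
move=> f2 [f2gr f2s]; apply: decomposes_unique f'd _.
by split=> // k; case: (f2gr k).
Qed.

End Grading.

Theorem theorem1 (G : zmodType) (F : fieldType) (R : unitAlgType F)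
    (gr : G -> set R) (gr_grading : grading gr) (gr_simple : graded_simple gr)
    (X : R) (X_unit : X \is a GRing.unit) (X_stab : stabilizes gr (Int X))
    (Xc : {fsfun G -> R with 0}) (X_dec : decomposes gr X Xc)
    (g : G) (Xg_neq0 : Xc g != 0) :
  Xc g \is a GRing.unit /\ Int (Xc g) =1 Int X.
Proof.
have XcE := component_intertwines _ _ _ _ gr_grading _ _ g X_unit X_stab X_dec.
(* Intertwining at the preimage of [r] under [Int X]: left multiples of [Xc g] are right
   multiples. *)
have XcE' r : r * Xc g = Xc g * (X^-1 * r * X).
  by rewrite XcE /Int !mulrA divrr // mul1r mulrK.
pose I := [set x | exists y, x = Xc g * y]%classic.
have grI : graded_subspace gr I.
  by apply: principal_graded => //; case: X_dec => Xgr _; apply: Xgr.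
have idI : two_sided_ideal I.
  split=> [|r x [y ->]]; first by case: grI.
  split; last by exists (y * r); rewrite mulrA.
  by exists (X^-1 * r * X * y); rewrite mulrA XcE' !mulrA.
have I1 : I 1.
  have [_ /(_ I idI grI)[I0|->//]] := gr_simple.
  have : I (Xc g) by exists 1; rewrite mulr1.
  by rewrite I0 /= => Xg0; rewrite Xg0 eqxx in Xg_neq0.
case: I1 => y yE.
have Xg_unit : Xc g \is a GRing.unit.
  (* [yE] only makes [y] a right inverse; intertwining makes [Int X y] a left one, so the two
     coincide. *)
  have lE : Int X y * Xc g = 1 by rewrite -XcE.
  apply/unitrP; exists y; split=> //.
  suff -> : y = Int X y by [].
  by rewrite -[LHS]mul1r -lE -mulrA -yE mulr1.
by split=> // Y; rewrite {1}/Int XcE mulrK.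
Qed.
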